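(* Let $\mathcal{M}^-$ denote the axiom system of the Hilbert plane with the Side-Angle-Side axiom removed (incidence, betweenness, and congruence axioms (C1)–(C5) as listed in the context; no continuity or parallel axiom). In every model of $\mathcal{M}^-$ in which the principles [HA] (hypotenuse-angle criterion for right triangles), [RCT] (ray correspondence) and [PE] (existence of the perpendicular from an external point), as spelled out in the context, all hold, the Side-Angle-Side criterion (SAS) holds: for all triangles $\triangle ABC$ and $\triangle DEF$, if $AB\equiv DE$, $AC\equiv DF$ and $\angle BAC\equiv\angle EDF$, then $\triangle ABC\equiv\triangle DEF$ (with $A,B,C$ corresponding to $D,E,F$ respectively).
   Context: **The axiom system $\mathcal{M}^-$.** Primitive notions: points, lines (with incidence), betweenness of points (written $A*B*C$: $B$ is between $A$ and $C$), congruence $\equiv$ of segments, congruence $\equiv$ of angles. The segment $AB$ ($A\neq B$) consists of $A$, $B$ and the points between them. The ray $\overrightarrow{AB}$ consists of $A$ and the points of line $AB$ on the same side of $A$ as $B$. An angle $\angle BAC$ is the unordered pair of rays $\overrightarrow{AB},\overrightarrow{AC}$ with $A,B,C$ not collinear. A triangle $\triangle ABC$ is determined by three non-collinear points. Incidence: (I1) any two distinct points lie on exactly one line; (I2) every line contains at least two points; (I3) there are three non-collinear points. Betweenness: (B1) if $A*B*C$ then $A,B,C$ are distinct and collinear and $C*B*A$; (B2) for distinct $A,B$ there is $C$ with $A*B*C$; (B3) of three distinct collinear points exactly one is between the other two; (B4) (Pasch) if $A,B,C$ are non-collinear and a line $l$ contains none of them but contains a point between $A$ and $B$, then $l$ contains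 a point between $A$ and $C$ or a point between $B$ and $C$, but not both. Congruence: (C1) given a segment $AB$ and a ray with origin $C$, there is a unique point $D\ne C$ on the ray with $AB\equiv CD$; (C2) segment congruence is an equivalence relation; (C3) if $A*B*C$, $D*E*F$, $AB\equiv DE$ and $BC\equiv EF$, then $AC\equiv DF$; (C4) given an angle $\angle BAC$, a ray $\overrightarrow{DF}$ and a side of line $DF$, there is a unique ray $\overrightarrow{DE}$ on that side with $\angle BAC\equiv\angle EDF$; (C5) angle congruence is an equivalence relation. The Hilbert plane is $\mathcal{M}^-$ together with SAS as a further axiom (C6); SAS is not assumed in $\mathcal{M}^-$. **Definitions.** Two triangles $\triangle ABC$ and $\triangle DEF$ are congruent, $\triangle ABC\equiv\triangle DEF$, if $AB\equiv DE$, $BC\equiv EF$, $CA\equiv FD$, $\angle A\equiv\angle D$, $\angle B\equiv\angle E$, $\angle C\equiv\angle F$. Two angles are supplementary if they share one side and their other sides are opposite rays. An angle is right if it is congruent to a supplementary angle of it. It is not assumed that all right angles are congruent to one another. Two lines are perpendicular if they meet at a point $O$ and some ray of one and some ray of the other, both with origin $O$, form a right angle. A right triangle is a triangle with a right angle at a designated vertex; its hypotenuse is the side opposite that vertex, and its ''acute angles'' are the angles at the other two vertices. A ray with origin $A$ lies within $\angle BAC$ if its points other than $A$ are on the same side of line $AB$ as $C$ and on the same side of line $AC$ as $B$. **The principles.** [HA] If $\triangle ABC$ has a right angle at $C$, $\triangle DEF$ has a right angle at $F$, $AB\equiv DE$ and $\angle BAC\equiv\angle EDF$, then $\triangle ABC\equiv\triangle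 DEF$. [RCT] (Hilbert's Theorem 13.) If the angle formed by rays $h,k$ is congruent to the angle formed by rays $h',k'$, and $l$ is a ray from the vertex of $\angle(h,k)$ lying within $\angle(h,k)$, then there is a ray $l'$ from the vertex of $\angle(h',k')$ lying within $\angle(h',k')$ such that $\angle(h,l)\equiv\angle(h',l')$ and $\angle(k,l)\equiv\angle(k',l')$. [PE] Given a line $l$ and a point $P$ not on $l$, there exists a line through $P$ perpendicular to $l$. *)

(* Defs.v *)
From mathcomp Require Import all_boot boolp classical_sets.

Set Implicit Arguments.
Unset Strict Implicit.
Unset Printing Implicit Defensive.

Local Open Scope classical_set_scope.

(* Segments and rays are sets of points and an angle is the unordered pair of
   its two rays, i.e. a set of sets of points, so the congruence relations are
   relations on these sets. Their values on sets that are not segments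
   (resp. angles) are irrelevant: no axiom mentions them. *)
Record geometry := Geometry {
  Point : Type;
  Line : Type;
  on : Point -> Line -> Prop;
  between : Point -> Point -> Point -> Prop; (* between A B C is A*B*C *)
  cong_seg : set Point -> set Point -> Prop;
  cong_ang : set (set Point) -> set (set Point) -> Prop
}.

Definition collinear {G : geometry} (A B C : Point G) : Prop :=
  exists l, [/\ on A l, on B l & on C l].

(* Meaningful for A <> B. *)
Definition line_through {G : geometry} (A B : Point G) : set (Point G) :=
  [set P | collinear A B P].

Definition segment {G : geometry} (A B : Point G) : set (Point G) :=
  [set P | P = A \/ P = B \/ between A P B].

(* X is the set of points of a line; in particular P and Q are not in X. *)
Definition same_side {G : geometry} (X : set (Point G)) (P Q : Point G) : Prop :=
  segment P Q `&` X = set0.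

(* Meaningful for A <> B; P and B are on the same side of A when A does not
   belong to the segment PB. *)
Definition ray {G : geometry} (A B : Point G) : set (Point G) :=
  [set P | P = A \/ (line_through A B P /\ ~ segment P B A)].

(* The angle BAC, with vertex A; meaningful for B, A, C not collinear. *)
Definition angle {G : geometry} (B A C : Point G) : set (set (Point G)) :=
  [set ray A B; ray A C].

Definition is_segment {G : geometry} (s : set (Point G)) : Prop :=
  exists A B, A <> B /\ s = segment A B.

Definition is_angle {G : geometry} (a : set (set (Point G))) : Prop :=
  exists A B C, ~ collinear A B C /\ a = angle B A C.

Definition equivalence_on {T : Type} (X : T -> Prop) (R : T -> T -> Prop) : Prop :=
  [/\ forall x, X x -> R x x,
      forall x y, X x -> X y -> R x y -> R y x &
      forall x y z, X x -> X y -> X z -> R x y -> R y z -> R x z].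

Record Mminus (G : geometry) : Prop := {
  I1 : forall A B : Point G, A <> B -> exists! l, on A l /\ on B l;
  I2 : forall l : Line G, exists A B, [/\ A <> B, on A l & on B l];
  (* Distinctness is not redundant: it excludes one point and no line. *)
  I3 : exists A B C : Point G,
    [/\ A <> B, A <> C, B <> C & ~ collinear A B C];

  B1 : forall A B C : Point G, between A B C ->
    [/\ A <> B, A <> C, B <> C, collinear A B C & between C B A];
  B2 : forall A B : Point G, A <> B -> exists C, between A B C;
  B3 : forall A B C : Point G,
    A <> B -> A <> C -> B <> C -> collinear A B C ->
    [\/ [/\ between A B C, ~ between B A C & ~ between A C B],
        [/\ ~ between A B C, between B A C & ~ between A C B] |
        [/\ ~ between A B C, ~ between B A C & between A C B]];
  B4 : forall (A B C : Point G) (l : Line G),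
    ~ collinear A B C -> ~ on A l -> ~ on B l -> ~ on C l ->
    (exists P, on P l /\ between A P B) ->
    ((exists P, on P l /\ between A P C) \/
     (exists P, on P l /\ between B P C)) /\
    ~ ((exists P, on P l /\ between A P C) /\
       (exists P, on P l /\ between B P C));

  C1 : forall A B C P : Point G, A <> B -> C <> P ->
    exists! D, [/\ D <> C, ray C P D & cong_seg (segment A B) (segment C D)];
  C2 : equivalence_on (@is_segment G) (@cong_seg G);
  C3 : forall A B C D E F : Point G, between A B C -> between D E F ->
    cong_seg (segment A B) (segment D E) ->
    cong_seg (segment B C) (segment E F) ->
    cong_seg (segment A C) (segment D F);
  (* The side of the line DF is given by a point P outside that line. *)
  C4 : forall A B C D F P : Point G,
    ~ collinear A B C -> D <> F -> ~ line_through D F P ->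
    exists! r : set (Point G), exists E,
      [/\ r = ray D E, same_side (line_through D F) E P &
          cong_ang (angle B A C) (angle E D F)];
  C5 : equivalence_on (@is_angle G) (@cong_ang G)
}.

Definition triangle {G : geometry} (A B C : Point G) : Prop :=
  ~ collinear A B C.

Definition cong_triangle {G : geometry} (A B C D E F : Point G) : Prop :=
  [/\ cong_seg (segment A B) (segment D E),
      cong_seg (segment B C) (segment E F) &
      cong_seg (segment C A) (segment F D)] /\
  [/\ cong_ang (angle B A C) (angle E D F),
      cong_ang (angle A B C) (angle D E F) &
      cong_ang (angle A C B) (angle D F E)].

Definition supplementary {G : geometry} (a b : set (set (Point G))) : Prop :=
  exists O P Q R : Point G,
    [/\ ~ collinear P O R, between P O Q, a = angle P O R & b = angle Q O R].

Definition right_angle {G : geometry} (a : set (set (Point G))) : Prop :=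
  exists b, supplementary a b /\ cong_ang a b.

Definition perpendicular {G : geometry} (l m : Line G) : Prop :=
  exists O P Q : Point G,
    [/\ on O l /\ on O m, on P l, on Q m, ~ collinear P O Q &
        right_angle (angle P O Q)].

(* The ray AD lies within the angle BAC. *)
Definition ray_within {G : geometry} (A D B C : Point G) : Prop :=
  A <> D /\
  forall P, ray A D P -> P <> A ->
    same_side (line_through A B) P C /\ same_side (line_through A C) P B.

(* Hypotenuse-angle criterion, with right angles at C and F. *)
Definition HA (G : geometry) : Prop :=
  forall A B C D E F : Point G,
    triangle A B C -> triangle D E F ->
    right_angle (angle A C B) -> right_angle (angle D F E) ->
    cong_seg (segment A B) (segment D E) ->
    cong_ang (angle B A C) (angle E D F) ->
    cong_triangle A B C D E F.

(* Ray correspondence, with h = AB, k = AC, l = AD and h' = A'B', k' = A'C',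
   l' = A'D'. *)
Definition RCT (G : geometry) : Prop :=
  forall A B C D A' B' C' : Point G,
    ~ collinear A B C -> ~ collinear A' B' C' ->
    cong_ang (angle B A C) (angle B' A' C') ->
    ray_within A D B C ->
    exists D', [/\ ray_within A' D' B' C',
      cong_ang (angle B A D) (angle B' A' D') &
      cong_ang (angle C A D) (angle C' A' D')].

(* Existence of the perpendicular from an external point. *)
Definition PE (G : geometry) : Prop :=
  forall (l : Line G) (P : Point G), ~ on P l ->
    exists m, on P m /\ perpendicular l m.

(* Main.v *)
(** First, [RCT] and the uniqueness part of (C4) make angles additive enough to
    show that supplements of congruent angles are congruent: otherwise the
    excess of one supplement over the other could be added to a copied angle,
    producing an angle equal to a straight one. Vertical angles are then
    congruent, and all right angles are congruent, as in Euclid.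

    Secondly, [HA] alone forbids a triangle with two right angles, hence the
    angles of a right triangle other than the right one are acute, and the foot
    of the perpendicular from B to AC lies on the ray AC exactly when the angle
    BAC is acute.

    A right triangle is determined by its legs: copy the angle and the
    hypotenuse, and [HA] puts the foot of the copy in the right place. For SAS,
    drop the perpendiculars from B to AC and from E to DF; [HA] compares the
    triangles at A and D, subtraction of segments and the comparison of legs
    give the angles at C and F. By symmetry the angles at B and E are congruent,
    and BC = EF follows from the uniqueness of copied segments and angles. *)

Require Import Defs.
From mathcomp Require Import all_boot boolp classical_sets.

Set Implicit Arguments.
Unset Strict Implicit.
Unset Printing Implicit Defensive.

Section HilbertPlane.
Context {G : geometry} (hM : Mminus G).
Implicit Types A B C D E F P Q R S T X Y Z : Point G.

(** * Incidence and the first properties of betweenness *)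

Lemma line_unique A B (l m : Line G) :
  A <> B -> on A l -> on B l -> on A m -> on B m -> l = m.
Proof.
move=> AB Al Bl Am Bm; have [k [_ ku]] := I1 hM AB.
by rewrite -(ku l) // -(ku m).
Qed.

Lemma collinear_refl A B : collinear A A B.
Proof.
have [AB|AB] := pselect (A = B); last first.
  by have [l [[Al Bl] _]] := I1 hM AB; exists l.
(* When the points coincide, [I3] still supplies a second point, hence a line through A. *)
subst B; have [P [Q [_ [PQ _ _ _]]]] := I3 hM.
have [C nAC] : exists C, A <> C.
  by have [AP|AP] := pselect (A = P); [exists Q; rewrite AP|exists P].
by have [l [[Al Bl] _]] := I1 hM nAC; exists l.
Qed.

Lemma collinear_swap12 A B C : collinear A B C -> collinear B A C.
Proof. by move=> [l [? ? ?]]; exists l. Qed.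

Lemma collinear_swap23 A B C : collinear A B C -> collinear A C B.
Proof. by move=> [l [? ? ?]]; exists l. Qed.

Lemma collinear_endl A B : collinear A B A.
Proof. exact/collinear_swap23/collinear_refl. Qed.

Lemma collinear_endr A B : collinear A B B.
Proof. exact/collinear_swap12/collinear_endl. Qed.

Lemma ncol_neq A B C : ~ collinear A B C -> [/\ A <> B, A <> C & B <> C].
Proof.
move=> N; split=> E; apply: N; subst.
- exact: collinear_refl.
- exact: collinear_endl.
- exact: collinear_endr.
Qed.

(* Like [same_side] for the line AB, except that P is required to be off it. *)
Definition same A B P Q : Prop :=
  [/\ ~ collinear A B P, ~ collinear A B Q &
      ~ exists X, collinear A B X /\ between P X Q].

Definition opposite A B P Q : Prop :=
  [/\ ~ collinear A B P, ~ collinear A B Q &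
      exists X, collinear A B X /\ between P X Q].

(* Marks the negated hypotheses that [incidence] has already processed. *)
Definition masked (P : Prop) : Prop := P.

Lemma bet_col A B C :
  between A B C -> [/\ A <> B, A <> C, B <> C & collinear A B C].
Proof. by case/(B1 hM). Qed.

Ltac merge_lines :=
  match goal with
  | N : ?A <> ?B, H1 : on ?A ?l, H2 : on ?B ?l, H3 : on ?A ?m, H4 : on ?B ?m
    |- _ =>
      lazymatch l with
      | m => fail
      | _ => let e := fresh in
             have e := line_unique N H1 H2 H3 H4; subst m
      end
  end.

(* Decides consequences of the incidence axioms: all lines known to the context
   are made explicit, and two of them sharing two distinct points merged. *)
Ltac incidence :=
  repeat match goal with
  | |- _ -> _ => intro
  | |- ~ _ => intro
  | |- collinear _ _ _ => apply: contrapT => ?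
  | |- ?A = ?B :> Point _ => apply: contrapT => ?
  end;
  exfalso; try assumption; subst; try done;
  repeat match goal with
  | H : same _ _ _ _ |- _ => move: H => [? ? _]
  | H : opposite _ _ _ _ |- _ => move: H => [? ? _]
  | H : between _ _ _ |- _ => move: (bet_col H) => {H} [? ? ? ?]
  | H : ~ collinear ?A ?B ?C |- _ =>
      move: (ncol_neq H) => [? ? ?];
      change (masked (~ collinear A B C)) in H
  | H : collinear _ _ _ |- _ => move: H => [? [? ? ?]]
  end;
  try done;
  repeat merge_lines;
  match goal with
  | N : masked (~ collinear ?A ?B ?C),
    H1 : on ?A ?l, H2 : on ?B ?l, H3 : on ?C ?l |- _ =>
      case: (N (ex_intro _ l (And3 H1 H2 H3)))
  end.

Lemma bet_sym A B C : between A B C -> between C B A.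
Proof. by case/(B1 hM). Qed.

Lemma bet_asym A B C : between A B C -> ~ between B A C.
Proof.
move=> b; have [AB nAC BC c] := bet_col b.
by case: (B3 hM AB nAC BC c) => [[]|[]|[]].
Qed.

Lemma bet_trichotomy A B C :
  A <> B -> A <> C -> B <> C -> collinear A B C ->
  [\/ between A B C, between B A C | between A C B].
Proof.
by move=> AB nAC BC c; case: (B3 hM AB nAC BC c) => [[]|[]|[]];
  [constructor 1|constructor 2|constructor 3].
Qed.

Lemma exists_ncol A B : A <> B -> exists C, ~ collinear A B C.
Proof.
move=> AB; apply: contrapT => /forallNP N.
have {}N C : collinear A B C by apply: contrapT; exact: N.
have [P [Q [R [_ _ _ PQR]]]] := I3 hM.
have [? ? ?] := And3 (N P) (N Q) (N R).
by incidence.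
Qed.

(** * The two sides of a line *)

Lemma same_sym A B P Q : same A B P Q -> same A B Q P.
Proof.
by move=> [p q N]; split=> // -[X [? /bet_sym ?]]; apply: N; exists X.
Qed.

Lemma opposite_sym A B P Q : opposite A B P Q -> opposite A B Q P.
Proof. by move=> [p q [X [? /bet_sym ?]]]; split=> //; exists X. Qed.

Lemma same_refl A B P : ~ collinear A B P -> same A B P P.
Proof. by move=> N; split=> // -[X [_ /bet_col[]]]. Qed.

Lemma same_or_opposite A B P Q :
  ~ collinear A B P -> ~ collinear A B Q -> same A B P Q \/ opposite A B P Q.
Proof.
move=> p q; have [N|N] :=
  pselect (exists X, collinear A B X /\ between P X Q); by [right|left].
Qed.

Lemma same_not_opposite A B P Q : same A B P Q -> ~ opposite A B P Q.
Proof. by move=> [_ _ N] [_ _ /N]. Qed.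

(** Pasch's axiom for the triangle PQR: its exclusive clause yields the [same] half of each
    alternative. *)
Lemma separation_ncol A B P Q R :
  ~ collinear P Q R -> opposite A B P Q -> ~ collinear A B R ->
  opposite A B P R /\ same A B Q R \/ same A B P R /\ opposite A B Q R.
Proof.
move=> PQR [p q [X [[l [Al Bl Xl]] b]]] r.
have AB : A <> B by case: (ncol_neq p).
have onE Y : on Y l <-> collinear A B Y.
  by split=> [Yl|[m [Am Bm Ym]]]; [exists l|rewrite (@line_unique A B l m)].
have e U V : (exists P0, on P0 l /\ between U P0 V) <->
    exists X, collinear A B X /\ between U X V.
  by split=> -[Y [/onE ? ?]]; exists Y.
have [] := B4 hM PQR (contra_not (onE P).1 p) (contra_not (onE Q).1 q)
  (contra_not (onE R).1 r); first by apply/e; exists X; split=> //; apply/onE.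
rewrite !(propext (e _ _)) => -[m|m] /not_andP n; [left|right]; split; split=> //;
  by case: n.
Qed.

Lemma separation A B P Q R :
  opposite A B P Q -> ~ collinear A B R ->
  opposite A B P R /\ same A B Q R \/ same A B P R /\ opposite A B Q R.
Proof.
move=> o r; have [PQR|/separation_ncol] := pselect (collinear P Q R); last exact.
have [p q [Z [ABZ b]]] := o.
have [RP|RP] := pselect (R = P).
  by subst R; right; split; [exact: same_refl|exact: opposite_sym].
have [RQ|RQ] := pselect (R = Q).
  by subst R; left; split=> //; exact: same_refl.
have AB : A <> B by case: (ncol_neq p).
(* When P, Q, R are collinear, an auxiliary point D off their line makes Pasch applicable. It is
   taken beyond P as seen from a point W of AB other than the crossing point Z, so D lies on the
   side of P. *)
have [W [ABW WZ]] : exists W, collinear A B W /\ W <> Z.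
  have [AZ|AZ] := pselect (A = Z); last first.
    by exists A; split=> //; exact: collinear_endl.
  exists B; split; last by move=> E; apply: AB; rewrite E AZ.
  exact: collinear_endr.
have WP : W <> P by move=> E; apply: p; rewrite -E.
have [D bD] := B2 hM WP.
have d : ~ collinear A B D by incidence.
have PQD : ~ collinear P Q D by incidence.
have sPD : same A B P D.
  split=> // -[V [ABV bV]].
  have E : V = W by incidence.
  by subst V; exact: (bet_asym bV (bD)).
have sND U V : same A B U V -> ~ opposite A B U V by exact: same_not_opposite.
have [[/sND//]|[_ oQD]] := separation_ncol PQD o d.
have QDR : ~ collinear Q D R by incidence.
have PDR : ~ collinear P R D by incidence.
have [[oQR sDR]|[sQR oDR]] := separation_ncol QDR oQD r.
  right; split=> //; have [//|oPR] := same_or_opposite p r.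
  have [[/sND//]|[_ /opposite_sym/sND//]] := separation_ncol PDR oPR d.
left; split=> //.
have DRP : ~ collinear D R P by incidence.
by have [[/opposite_sym/sND]|[_ /opposite_sym]] := separation_ncol DRP oDR p.
Qed.

Lemma opposite_opposite A B P Q R :
  opposite A B P Q -> opposite A B Q R -> same A B P R.
Proof.
move=> o1 o2; have [_ r _] := o2.
have [[_ /same_not_opposite/(_ o2)//]|[//]] := separation o1 r.
Qed.

Lemma opposite_same A B P Q R :
  opposite A B P Q -> same A B Q R -> opposite A B P R.
Proof.
move=> o1 s; have [_ r _] := s.
by have [[//]|[_ /(same_not_opposite s)]] := separation o1 r.
Qed.

Lemma same_trans A B P Q R : same A B P Q -> same A B Q R -> same A B P R.
Proof.
move=> s1 s2; have [p q _] := s1; have [_ r _] := s2.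
have [//|o] := same_or_opposite p r.
by have /(same_not_opposite s1) := opposite_same o (same_sym s2).
Qed.

(* The line AB may be given by any two of its points. *)
Lemma same_line A B C D P Q :
  C <> D -> collinear A B C -> collinear A B D -> same A B P Q -> same C D P Q.
Proof.
move=> CD ABC ABD [p q N]; split; [incidence|incidence|].
move=> [X [CDX b]]; apply: N; exists X; split=> //; incidence.
Qed.

(** * Order on a line, and rays *)

Lemma bet_opposite X Y A B C :
  ~ collinear X Y A -> collinear X Y B -> between A B C -> opposite X Y A C.
Proof. by move=> a b bABC; split=> //; [incidence|exists B]. Qed.

Lemma opposite_bet X Y A B C :
  opposite X Y A C -> collinear X Y B -> collinear A B C -> between A B C.
Proof.
move=> [a c [Z [XYZ b]]] XYB ABC.
by have <- : Z = B by incidence.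
Qed.

(* Any line through A other than AB cuts the line AB into the open ray AB and
   its opposite. *)
Lemma rayE A B X P : ~ collinear A X B ->
  ray A B P <-> P = A \/ collinear A B P /\ same A X B P.
Proof.
move=> N; have [AX AB XB] := ncol_neq N.
split=> -[->|]; [by left| |by left|].
- move=> [ABP nb]; have [->|PA] := pselect (P = A); [by left|right].
  have np : ~ collinear A X P by rewrite /line_through/= in ABP; incidence.
  split=> //; have [//|o] := same_or_opposite N np.
  case: nb; right; right; apply: (opposite_bet (opposite_sym o)).
    exact: collinear_endl.
  by rewrite /line_through/= in ABP; incidence.
- move=> [ABP s]; right; split=> // -[E|[E|b]].
  + by subst P; case: s => _ n _; apply: n; exact: collinear_endl.
  + by subst B; exact/N/collinear_endl.
  + have [_ np _] := s; apply: (same_not_opposite (same_sym s)).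
    by apply: (bet_opposite np _ b); exact: collinear_endl.
Qed.

Lemma ray_same A B X P : ~ collinear A X B -> ray A B P -> P <> A -> same A X B P.
Proof. by move=> N /(rayE _ N) [->|[]]. Qed.

Lemma same_ray A B X P : collinear A B P -> same A X B P -> ray A B P.
Proof. by move=> c s; have [N _ _] := s; apply/(rayE _ N); right. Qed.

Lemma ray_col A B P : A <> B -> ray A B P -> collinear A B P.
Proof. by move=> AB [->|[]//]; exact: collinear_endl. Qed.

Lemma eq_ray A B P : A <> B -> ray A B P -> P <> A -> ray A P = ray A B.
Proof.
move=> AB r PA; have ABP := ray_col AB r; have [X N] := exists_ncol AB.
have NB : ~ collinear A X B by incidence.
have NP : ~ collinear A X P by incidence.
have s := ray_same NB r PA.
apply/seteqP; split=> Q /=.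
- move=> /(rayE _ NP)[->|[c s']]; first by left.
  apply: (same_ray (X := X)); [incidence|exact: same_trans s s'].
- move=> /(rayE _ NB)[->|[c s']]; first by left.
  apply: (same_ray (X := X)); [incidence|exact: same_trans (same_sym s) s'].
Qed.

Lemma ray_end A B : A <> B -> ray A B B.
Proof.
move=> AB; right; split; first exact: collinear_endr.
by move=> [/AB|[/AB|/bet_col[]]].
Qed.

Lemma ray_sym A B P : A <> B -> ray A B P -> P <> A -> ray A P B.
Proof. by move=> AB r PA; rewrite (eq_ray AB r PA); exact: ray_end. Qed.

Lemma bet_ray A B C : between A B C -> ray A B C.
Proof.
move=> b; have [AB nAC BC ABC] := bet_col b; right; split=> //.
by move=> [/nAC|[/AB|/bet_sym/bet_asym]].
Qed.

Lemma bet_ray' A B C : between A B C -> ray A C B.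
Proof.
move=> b; have [AB nAC BC ABC] := bet_col b; apply: ray_sym (bet_ray b) _ => //.
exact: nesym.
Qed.

Lemma ray_or_bet A B P : A <> B -> collinear A B P -> P <> A ->
  ray A B P \/ between P A B.
Proof.
move=> AB c PA; have [b|nb] := pselect (between P A B); [by right|left; right].
by split=> // -[/esym|[/AB|]].
Qed.

Lemma ray_not_bet A B P : ray A B P -> ~ between P A B.
Proof. by move=> [->/bet_col[]//|[_ n] b]; apply: n; right; right. Qed.

Lemma bet_bet_ray A B C D : between A B C -> between D B C -> ray B A D.
Proof.
move=> b b'; have [AB nAC BC ABC] := bet_col b; have [DB DC _ DBC] := bet_col b'.
have [X N] := exists_ncol BC.
apply: (same_ray (X := X)); first by incidence.
apply: (@opposite_opposite _ _ _ C).
  by apply: (bet_opposite _ _ b); [incidence|exact: collinear_endl].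
apply: opposite_sym.
by apply: (bet_opposite _ _ b'); [incidence|exact: collinear_endl].
Qed.

Lemma ray_bet A B C P : between B A C -> ray A B P -> P <> A -> between P A C.
Proof.
move=> b r PA; have [/nesym AB BC nAC c] := bet_col b.
have c' := ray_col AB r; have [X N] := exists_ncol AB.
apply: (opposite_bet (X := A) (Y := X)); last by incidence.
  apply: opposite_sym; apply: opposite_same (ray_same _ r PA); last by incidence.
  apply: opposite_sym.
  by apply: (bet_opposite _ _ b); [incidence|exact: collinear_endl].
exact: collinear_endl.
Qed.

(** If the origins differed, a point beyond C as seen from A would lie on the ray AC, hence on the
    equal ray CA, with C separating it from A. *)
Lemma ray_origin A B C D : A <> B -> C <> D -> ray A B = ray C D -> A = C.
Proof.
move=> AB CD e; apply: contrapT => nAC.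
have CA : C <> A by exact: nesym.
have rC : ray A B C by rewrite e; left.
have rA : ray C D A by rewrite -e; left.
have [E b] := B2 hM nAC.
have : ray A C E := bet_ray b.
by rewrite (eq_ray AB rC CA) e -(eq_ray CD rA nAC) => /ray_not_bet; apply; exact: bet_sym.
Qed.

Lemma same_side_same A B P Q :
  ~ collinear A B P -> same_side (line_through A B) P Q <-> same A B P Q.
Proof.
move=> p; split=> [e|[_ q N]].
- have n X : segment P Q X -> ~ collinear A B X.
    move=> s c; suff : set0 X by []; by rewrite -e.
  split=> //; first by apply: n; right; left.
  by move=> [X [c b]]; apply: (n X) => //; right; right.
- apply/seteqP; split=> // X [s c]; case: s => [?|[?|b]]; [subst X..|] => //.
  by apply: N; exists X.
Qed.

(** * Interiors of angles *)

(** Tests only the point D of the ray; [ray_within_inside] relates it to [ray_within]. *)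
Definition inside A D B C : Prop := same A B D C /\ same A C D B.

Lemma inside_sym A D B C : inside A D B C -> inside A D C B.
Proof. by case. Qed.

Lemma inside_ray A D B C P :
  inside A D B C -> ray A D P -> P <> A -> inside A P B C.
Proof.
move=> [s1 s2] r PA; have [n1 _ _] := s1; have [n2 _ _] := s2.
by split; [apply: same_trans s1|apply: same_trans s2]; apply: same_sym;
  exact: ray_same.
Qed.

Lemma ray_within_inside A D B C :
  ~ collinear A B C -> ray_within A D B C <-> inside A D B C.
Proof.
move=> N; have N' : ~ collinear A C B by incidence.
split=> [[AD]|i].
- move=> /(_ D (ray_end AD) (nesym AD)) [s1 s2].
  have n1 : ~ collinear A B D.
    by move=> c; suff : set0 D by []; rewrite -s1; split=> //; left.
  have n2 : ~ collinear A C D.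
    by move=> c; suff : set0 D by []; rewrite -s2; split=> //; left.
  by split; exact/same_side_same.
- split=> [|P r PA].
    by case: i => -[n _ _] _ E; subst; apply: n; exact: collinear_endl.
  have [[p1 q1 n1] [p2 q2 n2]] := inside_ray i r PA.
  by split; apply/same_side_same.
Qed.

(** Prolong CA beyond A to C'. If the line AD met BC' at X, then X and D would lie on the same side
    of AC but on opposite sides of AB, which fails whether X is on the ray AD or on its opposite. So
    B is on the side of C', away from C. *)
Lemma inside_opposite A D B C : inside A D B C -> opposite A D B C.
Proof.
move=> [s1 s2]; have [n1 n2 _] := s1; have [n3 n4 _] := s2.
have [AD CA] : A <> D /\ C <> A.
  by have [] := ncol_neq n1; have [] := ncol_neq n2 => *; split=> //; exact: nesym.
have [C' b] := B2 hM CA; have [_ CC' nAC' CAC'] := bet_col b.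
have nB : ~ collinear A D B by incidence.
have nC : ~ collinear A D C by incidence.
have nC' : ~ collinear A D C' by incidence.
have oC : opposite A D C' C.
  by apply: opposite_sym; apply: (bet_opposite nC _ b); exact: collinear_endl.
have [s|[_ _ [X [ADX b']]]] := same_or_opposite nB nC'.
  by apply: opposite_sym; apply: opposite_same (same_sym s); exact: opposite_sym.
exfalso; have [BX BC' XC' c'] := bet_col b'.
have XA : X <> A by incidence.
have o1 : opposite A B D X.
  apply: opposite_sym; apply: (@opposite_same _ _ _ C); last exact: same_sym.
  apply: opposite_sym; apply: (@opposite_same _ _ _ C').
    by apply: (bet_opposite n2 _ b); exact: collinear_endl.
  apply: (@same_line B A); [incidence|exact: collinear_endr|exact: collinear_endl|].
  by apply: ray_same (bet_ray' b') _; [incidence|exact: nesym].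
have s : same A C D X.
  apply: same_trans s2 _; apply: (@same_line C' A);
    [exact: nesym|exact: collinear_endr|incidence|].
  by apply: ray_same (bet_ray' (bet_sym b')) _; [incidence|].
have [r|r] := ray_or_bet AD ADX XA.
  by apply: (same_not_opposite _ o1); exact: ray_same r XA.
apply: (same_not_opposite (same_sym s)).
by have [_ ? _] := s; apply: (bet_opposite _ _ r) => //; exact: collinear_endl.
Qed.

Lemma crossbar A D B C :
  inside A D B C -> exists X, [/\ between B X C, ray A D X & X <> A].
Proof.
move=> i; have [s1 s2] := i; have [nB nC [X [ADX b]]] := inside_opposite i.
have [n1 n2 _] := s1; have [BX BC XC BXC] := bet_col b.
have XA : X <> A by incidence.
exists X; split=> //; apply: (same_ray (X := C)) => //; apply: same_trans s2 _.
apply: (@same_line C A); [incidence|exact: collinear_endr|exact: collinear_endl|].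
by apply: ray_same (bet_ray' (bet_sym b)) _; [incidence|].
Qed.

(** This orders angles with common side AB. If the line AD separates B from C, its intersection with
    BC lies on the ray AD, which puts D inside BAC. *)
Lemma inside_trichotomy A B C D : same A B C D ->
  [\/ collinear A C D, inside A D B C | inside A C B D].
Proof.
move=> s; have [n1 n2 _] := s.
have [c|n] := pselect (collinear A C D); [by constructor 1|].
have nB : ~ collinear A D B by incidence.
have nC : ~ collinear A D C by incidence.
have [s'|[_ _ [X [ADX b]]]] := same_or_opposite nB nC.
  by constructor 3; split=> //; exact: same_sym.
constructor 2; split; first exact: same_sym.
have [BX BC XC BXC] := bet_col b.
have XA : X <> A by incidence.
have sX : same A B D X.
  apply: same_trans (same_sym s) _; apply: (@same_line B A);
    [incidence|exact: collinear_endr|exact: collinear_endl|].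
  by apply: ray_same (bet_ray' b) _; [incidence|exact: nesym].
have r : ray A D X by exact: same_ray sX.
apply: (@same_trans _ _ _ X); first by apply: ray_same r XA; incidence.
apply: (@same_line C A); [incidence|exact: collinear_endr|exact: collinear_endl|].
apply: same_sym.
by apply: ray_same (bet_ray' (bet_sym b)) _; [incidence|].
Qed.

(** * Congruence of angles *)

(** Nondegeneracy is bundled in because [C5] speaks of genuine angles only; [scong] does the same
    for segments. *)
Definition acong B A C E D F : Prop :=
  [/\ ~ collinear B A C, ~ collinear E D F &
      cong_ang (angle B A C) (angle E D F)].

Lemma angle_sym B A C : angle B A C = angle C A B.
Proof. by rewrite /angle setUC. Qed.

Lemma is_angle_angle B A C : ~ collinear B A C -> is_angle (angle B A C).
Proof. by move=> N; exists A, B, C; split=> //; incidence. Qed.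

Lemma acong_refl B A C : ~ collinear B A C -> acong B A C B A C.
Proof.
by move=> N; have [r _ _] := C5 hM; split=> //; apply: r; exact: is_angle_angle.
Qed.

Lemma acong_sym B A C E D F : acong B A C E D F -> acong E D F B A C.
Proof.
move=> [n1 n2 c]; have [_ s _] := C5 hM; split=> //.
by apply: s => //; exact: is_angle_angle.
Qed.

Lemma acong_trans B A C E D F P O Q :
  acong B A C E D F -> acong E D F P O Q -> acong B A C P O Q.
Proof.
move=> [n1 n2 c] [_ n3 c']; have [_ _ t] := C5 hM; split=> //.
by apply: t c c'; exact: is_angle_angle.
Qed.

Lemma acong_swapl B A C E D F : acong B A C E D F -> acong C A B E D F.
Proof. by move=> [n1 n2]; rewrite angle_sym; split=> //; incidence. Qed.

Lemma acong_swap B A C E D F : acong B A C E D F -> acong C A B F D E.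
Proof. by move=> /acong_swapl/acong_sym/acong_swapl/acong_sym. Qed.

Lemma acong_rayl B A C E D F P :
  acong B A C E D F -> ray A B P -> P <> A -> acong P A C E D F.
Proof.
move=> [n1 n2 c] r PA; have AB : A <> B by incidence.
have ABP := ray_col AB r.
by split=> //; [incidence|rewrite /angle (eq_ray AB r PA)].
Qed.

Lemma acong_rayr B A C E D F P :
  acong B A C E D F -> ray A C P -> P <> A -> acong B A P E D F.
Proof. by move=> /acong_swapl c r PA; apply/acong_swapl/(acong_rayl c). Qed.

Lemma acong_unique D F E E' :
  same D F E E' -> acong E D F E' D F -> ray D E E'.
Proof.
move=> s [n1 n2 c]; have [m1 m2 _] := s.
have DE : D <> E' by incidence.
have n3 : ~ collinear D E F by incidence.
have DF : D <> F by incidence.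
have [r [_ u]] := C4 hM n3 DF m2.
have -> : ray D E = ray D E'; last exact: ray_end.
transitivity r; [symmetry|]; apply: u.
- exists E; split=> //; first exact/same_side_same.
  by have [] := acong_refl n1.
- exists E'; split=> //.
  by apply/same_side_same => //; exact: same_refl.
Qed.

Lemma acong_copy B A C D F P : ~ collinear B A C -> ~ collinear D F P ->
  exists E, same D F P E /\ acong B A C E D F.
Proof.
move=> n p; have DF : D <> F by incidence.
have n' : ~ collinear A B C by incidence.
have [_ [[E [_ s c]] _]] := C4 hM n' DF p.
have e : ~ collinear D F E.
  by move=> c'; suff : set0 E by []; rewrite -s; split=> //; left.
have {}s : same D F E P by exact/same_side_same.
by exists E; split; [exact: same_sym|split=> //; incidence].
Qed.

(** * Ray correspondence and supplementary angles *)

Context (hRCT : RCT G).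

Lemma ray_correspondence A B C D A' B' C' :
  acong B A C B' A' C' -> inside A D B C ->
  exists D', [/\ inside A' D' B' C', acong B A D B' A' D' &
                 acong C A D C' A' D'].
Proof.
move=> [n1 n2 c] i; have [[nD nC _] [nD' nB _]] := i.
have n' : ~ collinear A' B' C' by incidence.
have [] := hRCT _ _ c ((ray_within_inside _ nC).2 i); [incidence|incidence|].
move=> T [/(ray_within_inside _ n') iT c2 c3].
have [[nT _ _] [nT' _ _]] := iT.
by exists T; split=> //; split=> //; incidence.
Qed.

(** The ray provided by [RCT] and the ray A'D' copy the same angle on the same side of A'B', so
    uniqueness in (C4) identifies them. *)
Lemma ray_correspondence_unique A B C D A' B' C' D' :
  acong B A C B' A' C' -> inside A D B C -> same A' B' C' D' ->
  acong B A D B' A' D' -> inside A' D' B' C' /\ acong C A D C' A' D'.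
Proof.
move=> c i s c1; have [T [iT c2 c3]] := ray_correspondence c i.
have r : ray A' T D'.
  apply: (@acong_unique _ B'); first by apply: same_trans s; case: iT.
  exact/acong_swap/(acong_trans _ c1)/acong_sym.
have D'A' : D' <> A' by case: c1 => _ ? _; incidence.
split; first exact: inside_ray r _.
exact/acong_sym/(acong_rayr (acong_sym c3)).
Qed.

(** R lies inside POT. Copy POT as P'O'S; then R' lies inside P'O'S and the angle SO'R' is congruent
    to TOR, so under the excluded congruence to Q'O'R'. Uniqueness then puts Q' on the ray O'S,
    although S is off the line P'Q'. *)
Lemma supplement_inside P O Q R T P' O' Q' R' :
  between P O Q -> between P' O' Q' -> acong P O R P' O' R' ->
  inside O T Q R -> ~ acong R O T R' O' Q'.
Proof.
move=> b b' c i cT; have [sQ sR] := i; have [nT nR _] := sQ; have [nT' nQ _] := sR.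
have [n n' _] := c.
have iR : inside O R P T.
  split; first by apply: (same_line _ _ _ (same_sym sQ)); incidence.
  apply: opposite_opposite (opposite_sym (inside_opposite i)) _.
  apply: opposite_sym; apply: (bet_opposite _ _ b); first by incidence.
  exact: collinear_endl.
have nTP : ~ collinear T O P by incidence.
have nPR : ~ collinear O' P' R' by incidence.
have [S [s /acong_swap cS]] := acong_copy nTP nPR.
have [iR' cTR] := ray_correspondence_unique cS iR (same_sym s) c.
have cSQ : acong S O' R' Q' O' R'.
  exact: acong_trans (acong_sym cTR) (acong_swap cT).
have r : ray O' S Q'.
  apply: acong_unique cSQ.
  apply: opposite_opposite (opposite_sym (inside_opposite iR')) _.
  by apply: (bet_opposite _ _ b'); [incidence|exact: collinear_endl].
have OS : O' <> S by incidence.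
by have := ray_col OS r; incidence.
Qed.

Lemma acong_supplement P O Q R P' O' Q' R' :
  between P O Q -> between P' O' Q' -> acong P O R P' O' R' ->
  acong Q O R Q' O' R'.
Proof.
move=> b b' c; have [n n' _] := c.
have nQ' : ~ collinear Q' O' R' by incidence.
have nQ : ~ collinear O R Q by incidence.
have [T [s cT]] := acong_copy nQ' nQ.
have TO : T <> O by case: s; incidence.
case: (inside_trichotomy s) => [col|i|i].
- have r : ray O T Q.
    by apply: same_ray (same_sym s); incidence.
  by apply/acong_sym/acong_sym/(acong_rayl _ r); [exact: acong_sym|incidence].
- case: (supplement_inside b b' c (inside_sym i)).
  exact/acong_swap/acong_sym.
(* Here the supplement at O is the smaller one: [RCT] carries Q into the angle R'O'Q', and the
   previous case applies with the two figures exchanged. *)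
- have [T' [iT c1 _]] := ray_correspondence (acong_swap (acong_sym cT)) i.
  by case: (supplement_inside b' b (acong_sym c) (inside_sym iT)); exact: acong_sym.
Qed.

(** * Right angles *)

(** Needed because [right_angle] is witnessed by points unrelated to those naming the angle, and an
    unordered pair of rays leaves the order of the sides open. *)
Lemma angle_inj A C B P O R :
  ~ collinear A C B -> ~ collinear P O R -> angle A C B = angle P O R ->
  C = O /\ (ray O P A /\ ray O R B \/ ray O R A /\ ray O P B).
Proof.
move=> n1 n2 e.
have CA : C <> A by incidence.
have CB : C <> B by incidence.
have OP : O <> P by incidence.
have OR : O <> R by incidence.
have rA := ray_end CA; have rB := ray_end CB.
have E : C = O.
  have : angle P O R (ray C A) by rewrite -e; left.
  by case=> /ray_origin; apply.
subst O; split=> //.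
have : angle P C R (ray C A) by rewrite -e; left.
have : angle P C R (ray C B) by rewrite -e; right.
case=> /= eB [] /= eA; rewrite eA in rA; rewrite eB in rB; try by [left|right].
- by have := ray_col OP rA; have := ray_col OP rB; incidence.
- by have := ray_col OR rA; have := ray_col OR rB; incidence.
Qed.

(** Point form of [right_angle], always prolonging the side CA; by [right_sym], CB would do as
    well. *)
Definition right A C B : Prop :=
  ~ collinear A C B /\ forall A', between A C A' -> acong A C B A' C B.

Lemma right_sym A C B : right A C B -> right B C A.
Proof.
move=> [n h]; split=> [|B' b']; first by incidence.
have CA : A <> C by incidence.
have [A' b] := B2 hM CA.
(* The supplements obtained by prolonging either side are vertical angles. *)
apply/(acong_trans (acong_swapl (h _ b)))/(acong_supplement b b').
exact/acong_sym/acong_swapl/acong_refl.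
Qed.

Lemma right_line A C B X : right A C B -> collinear A C X -> X <> C -> right X C B.
Proof.
move=> [n h] c XC; have CA : C <> A by incidence.
have nX : ~ collinear X C B by incidence.
split=> // X' b.
have bX' := bet_sym b.
have [r|bX] := @ray_or_bet C A X CA ltac:(incidence) XC.
  exact: acong_rayl (h _ (ray_bet b (ray_sym CA r XC) (nesym CA))) r XC.
apply: acong_trans (acong_sym (h X (bet_sym bX))) _.
apply: acong_sym.
by apply: acong_rayl (acong_refl n) (bet_bet_ray (bet_sym bX) bX') _; incidence.
Qed.

Lemma right_angleE A C B : ~ collinear A C B ->
  right_angle (angle A C B) <-> right A C B.
Proof.
move=> n; split=> [[a [[O [P [Q [R [nPR b e ->]]]]]]]|[_ h]]; last first.
  have nAC : A <> C by incidence.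
  have [A' b] := B2 hM nAC; have c := h A' b.
  by exists (angle A' C B); split; [exists C, A, A', B|case: c].
rewrite e => c; have [E rays] := angle_inj n nPR e; subst O.
have CP : C <> P by incidence.
have CR : C <> R by incidence.
have nQR : ~ collinear Q C R by incidence.
have rPR : right P C R.
  split=> // P' b'.
  apply/acong_sym/(@acong_rayl Q);
    [|exact: bet_bet_ray (bet_sym b) (bet_sym b')|incidence].
  exact/acong_sym.
have AC' : A <> C by incidence.
have BC' : B <> C by incidence.
have right_rays U V : right U C V -> ray C U A -> ray C V B -> right A C B.
  move=> rUV rA rB; have [n' _] := rUV.
  have CU : C <> U by incidence.
  have CV : C <> V by incidence.
  apply: (@right_line U) => //; last exact/collinear_swap12/ray_col.
  apply/right_sym/(@right_line V) => //; first exact: right_sym.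
  exact/collinear_swap12/ray_col.
by case: rays => -[rA rB]; apply: right_rays rA rB => //; exact: right_sym.
Qed.

Lemma right_transfer A C B D F E : right A C B -> acong A C B D F E -> right D F E.
Proof.
move=> [n h] c; have [_ n' _] := c; split=> // D' b'.
have nAC : A <> C by incidence.
have [A' b] := B2 hM nAC.
apply: acong_trans (acong_sym c) (acong_trans (h A' b) _).
exact: acong_supplement c.
Qed.

(** Prolong DF to D'. Ray correspondence from DFE to D'FE sends T to a ray which, as DFT is right
    too, is FT itself. Then T is on the sides of FE containing D and D' at once. *)
Lemma right_inside D F E T : right D F E -> right D F T -> ~ inside F T D E.
Proof.
move=> [n h] [n' h'] i; have DF : D <> F by incidence.
have [D' b] := B2 hM DF; have [_ _ FD' DFD'] := bet_col b.
have [T' [iT c _]] := ray_correspondence (h D' b) i.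
have DD' : F <> D' by [].
have sD' : same F D' E T.
  by case: i => s _; apply: (same_line _ _ _ (same_sym s)); incidence.
have r : ray F T' T.
  apply: (@acong_unique _ D'); first by apply: same_trans sD'; case: iT.
  exact/acong_swap/(acong_trans (acong_sym c))/h'.
have TF : T <> F by incidence.
have [[_ s] [_ s']] := (i, inside_ray iT r TF).
apply: (same_not_opposite (same_trans (same_sym s) s')).
by case: s => _ ? _; apply: (bet_opposite _ _ b) => //; exact: collinear_endl.
Qed.

Lemma right_unique D F E T :
  right D F E -> right D F T -> same F D E T -> ray F E T.
Proof.
move=> rE rT s; case: (inside_trichotomy s) => [c|i|i].
- by apply: same_ray s.
- by case: (right_inside rE rT).
- by case: (right_inside rT rE).
Qed.

Lemma exists_right A C B D F P : right A C B -> ~ collinear F D P ->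
  exists T, same F D P T /\ right D F T.
Proof.
move=> r n; have [n' _] := r.
have n'' : ~ collinear B C A by incidence.
have [T [s c]] := acong_copy n'' n.
by exists T; split=> //; exact/(right_transfer r)/acong_swap.
Qed.

(** Euclid's fourth postulate: a copy of ACB along FD is again right, and [right_unique] identifies
    its second side with FE. *)
Lemma right_acong A C B D F E : right A C B -> right D F E -> acong A C B D F E.
Proof.
move=> r r'; have [[n _] [n' _]] := (r, r').
have nB : ~ collinear B C A by incidence.
have nE : ~ collinear F D E by incidence.
have [T [s /acong_swap c]] := acong_copy nB nE.
have rT := right_unique r' (right_transfer r c) s.
have FE : F <> E by incidence.
have [_ nT _] := c.
have TF : T <> F by incidence.
apply/acong_sym/(acong_rayr (acong_sym c)); first exact: ray_sym rT TF.
exact: nesym.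
Qed.

(** * Congruence of segments *)

Lemma segment_sym A B : segment A B = segment B A.
Proof.
apply/seteqP; split=> X [->|[->|/bet_sym]]; by [left|right; left|right; right].
Qed.

Definition scong A B C D : Prop :=
  [/\ A <> B, C <> D & cong_seg (segment A B) (segment C D)].

Lemma is_segment_segment A B : A <> B -> is_segment (segment A B).
Proof. by exists A, B. Qed.

Lemma scong_refl A B : A <> B -> scong A B A B.
Proof.
by move=> AB; have [r _ _] := C2 hM; split=> //; apply: r; exact: is_segment_segment.
Qed.

Lemma scong_swap A B C D : scong A B C D -> scong B A D C.
Proof.
by move=> [AB CD c]; split; [exact: nesym|exact: nesym|];
  rewrite (segment_sym B) (segment_sym D).
Qed.

Lemma scong_unique A B C D D' :
  scong A B C D -> scong A B C D' -> ray C D D' -> D = D'.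
Proof.
move=> [AB CD c] [_ CD' c'] r; have [X [_ u]] := C1 hM AB CD.
transitivity X; [symmetry|]; apply: u; split=> //; try exact: nesym.
exact: ray_end.
Qed.

Lemma scong_copy A B C P : A <> B -> C <> P -> exists D, ray C P D /\ scong A B C D.
Proof.
move=> AB CP; have [D [[DC r c] _]] := C1 hM AB CP.
by exists D; split=> //; split=> //; exact: nesym.
Qed.

Lemma scong_bet A B C D E F : between A B C -> between D E F ->
  scong A B D E -> scong B C E F -> scong A C D F.
Proof.
move=> b b' [_ _ c] [_ _ c']; have [[_ ? _ _] [_ ? _ _]] := (bet_col b, bet_col b').
by split=> //; exact: C3 b b' c c'.
Qed.

(** (C3) only adds, so BC is laid off beyond E up to F', and uniqueness in (C1) gives F' = F. *)
Lemma scong_sub A B C D E F : between A B C -> ray D E F ->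
  scong A B D E -> scong A C D F -> between D E F /\ scong B C E F.
Proof.
move=> b r c1 c2; have [[_ _ BC _] [_ DE _]] := (bet_col b, c1).
have [P bP] := B2 hM DE; have [_ _ EP _] := bet_col bP.
have [F' [rF' cF']] := scong_copy BC EP.
have F'E : F' <> E by have [_ /nesym] := cF'.
have bF' := bet_sym (ray_bet (bet_sym bP) rF' F'E).
suff -> : F = F' by [].
have [_ nDF _] := c2; have FD : F <> D := nesym nDF.
apply: (scong_unique c2); first exact: scong_bet b bF' c1 cF'.
rewrite (eq_ray DE r FD); exact: bet_ray.
Qed.

(** * Feet of perpendiculars *)

Context (hHA : HA G) (hPE : PE G).

Lemma hypotenuse_angle A B C D E F :
  right A C B -> right D F E -> scong A B D E -> acong B A C E D F ->
  [/\ scong B C E F, scong C A F D & acong A B C D E F].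
Proof.
move=> r r' [AB DE c] [n n' c']; have [[m _] [m' _]] := (r, r').
have t : triangle A B C by move=> ?; incidence.
have t' : triangle D E F by move=> ?; incidence.
have [[_ c1 c2] [_ c3 _]] :=
  hHA t t' ((right_angleE m).2 r) ((right_angleE m').2 r') c c'.
by split; split=> //; incidence.
Qed.

(* If B and C were two feet of perpendiculars from A, pick D on the line BC
   beyond B: the right triangles DBA and DCA share the hypotenuse DA and the
   angle at D, so DB = DC. *)
Lemma right_not_right A B C : right A B C -> ~ right A C B.
Proof.
move=> r r'; have [n _] := r; have CB : C <> B by incidence.
have [D b] := B2 hM CB; have [_ CD BD c] := bet_col b.
have rB : right D B A.
  by apply: (@right_line C) (nesym BD); [exact: right_sym|incidence].
have rC : right D C A.
  by apply: (@right_line B) (nesym CD); [exact: right_sym|incidence].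
have DA : D <> A by incidence.
have a : acong A D B A D C.
  apply: acong_rayr (acong_refl _) (bet_ray' (bet_sym b)) BD.
  by incidence.
have [_ /scong_swap s _] := hypotenuse_angle rB rC (scong_refl DA) a.
apply: CB; apply/esym/(scong_unique (scong_refl (nesym BD)) s).
exact: bet_ray (bet_sym b).
Qed.

(** The angle HAB is acute: were T on the line AB or inside HAB, a triangle with right angles at A
    and H would arise, in the latter case through the crossbar point X on HB. *)
Lemma right_inside_right A H B T :
  right A H B -> right H A T -> same A H B T -> inside A B H T.
Proof.
move=> r r' s; have [n _] := r.
case: (inside_trichotomy s) => [c||] //.
  have BA : B <> A by incidence.
  have r2 : right B A H.
    by apply: (@right_line T) BA; [exact: right_sym|have [_ ? _] := s; incidence].
  by case: (right_not_right r2); exact: right_sym.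
case/crossbar => X [b rX XA]; have [HX HB XB c] := bet_col b.
have AT' : A <> T by case: r' => ? _; incidence.
have r2 : right X A H.
  by apply: (@right_line T) XA; [exact: right_sym|exact/collinear_swap12/ray_col].
case: (right_not_right r2); apply: (@right_line B) (nesym HX); last by incidence.
exact: right_sym.
Qed.

(** X is left free since the foot may coincide with A or B. *)
Lemma exists_foot A B P : ~ collinear A B P -> exists H, collinear A B H /\
  forall X, collinear A B X -> X <> H -> right X H P.
Proof.
move=> n; have AB : A <> B by incidence.
have [l [[Al Bl] _]] := I1 hM AB.
have nP : ~ on P l by move=> Pl; apply: n; exists l.
have [m [Pm [H [Q [R [[Hl Hm] Ql Rm nQHR]]]]]] := hPE nP.
move=> /(right_angleE nQHR) r.
have c : collinear H R P by exists m.
have PH : P <> H by move=> E; apply: nP; rewrite E.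
have rP : right P H Q.
  by apply: (@right_line R) (collinear_swap12 c) PH; exact: right_sym.
exists H; split; first by exists l.
move=> X ABX XH; apply: (@right_line Q) XH; first exact: right_sym.
have c' : collinear A B Q by exists l.
have c2 : collinear A B H by exists l.
by have := AB; incidence.
Qed.

(** Erect perpendiculars AT and DS. B is inside HAT, so ray correspondence puts E inside FDS; but E
    is also inside KDS. Thus F and K are on the same side of DS, and D cannot separate them. *)
Lemma foot_not_bet A B C D E F H K :
  acong B A C E D F -> right A H B -> right D K E -> ray A C H -> ~ between K D F.
Proof.
move=> c r r' rH b; have [[nC nF _] [[nH _] [nK _]]] := (c, (r, r')).
have nAHB : ~ collinear H A B by incidence.
have nDKE : ~ collinear D K E by incidence.
have nAHB' : ~ collinear A H B by incidence.
have [T [sT rT]] := exists_right r nAHB'.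
have [S [sS rS]] := exists_right r' nDKE.
have [KD KF DF KDF] := bet_col b.
have iB := right_inside_right r rT sT.
have iE := right_inside_right r' rS sS.
have rS' : right F D S by apply: (@right_line K) => //; incidence.
have HA' : H <> A by incidence.
have s : same D F S E.
  by apply: (same_line _ _ _ (same_sym sS)); incidence.
have cH := acong_swap (acong_rayr c rH HA').
have [[_ s1] _] := ray_correspondence_unique (right_acong rT rS') iB s cH.
have [_ s2] := iE.
apply: (same_not_opposite (same_trans (same_sym s2) s1)).
have [_ nK' _] := s2.
by apply: (bet_opposite _ _ b) => //; exact: collinear_endl.
Qed.

Lemma foot_ray A B C D E F H K :
  acong B A C E D F -> right A H B -> right D K E -> ray A C H ->
  collinear D F K -> ray D F K.
Proof.
move=> c r r' rH DFK; have [[_ n _] [n' _]] := (c, r').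
have DF : D <> F by incidence.
have KD : K <> D by incidence.
by have [//|/(foot_not_bet c r r' rH)] := ray_or_bet DF DFK KD.
Qed.

(* A copy of the angle HBC at E, with hypotenuse BC, has its foot at K by
   [hypotenuse_angle], hence its far vertex is F. *)
Lemma legs B C H E F K :
  right B H C -> right E K F -> scong B H E K -> scong H C K F ->
  acong B C H E F K.
Proof.
move=> r r' c1 c2; have [[n _] [n' _]] := (r, r').
have nCBH : ~ collinear C B H by incidence.
have nEKF : ~ collinear E K F by [].
have [X [sX cX]] := acong_copy nCBH nEKF.
have BC : B <> C by incidence.
have EX : E <> X by incidence.
have [P [rP cP]] := scong_copy BC EX.
have PE' : P <> E by have [_ /nesym] := cP.
have {sX} s : same E K F P.
  apply: (same_trans sX); apply: ray_same rP PE'; incidence.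
have {cX} c : acong C B H P E K.
  exact/acong_sym/(acong_rayl (acong_sym cX) rP PE').
have [_ nEKP _] := s; have EK : E <> K by incidence.
have [L [cL foot]] := exists_foot nEKP.
(* Otherwise the angle CBH would be right, a second right angle in the triangle BHC. *)
have LE : L <> E.
  move=> E0; subst L; have rKEP := foot K (collinear_endr _ _) (nesym EK).
  have := right_transfer rKEP (acong_swap (acong_sym c)).
  by move=> /right_sym/right_not_right; apply; exact: right_sym.
have rL : right E L P by apply: foot (nesym LE); exact: collinear_endl.
have HB : H <> B by incidence.
have rH : ray B H H by apply: ray_end; exact: nesym.
have rKL := foot_ray c r rL rH cL.
have [d1 d2 d3] := hypotenuse_angle r rL cP (acong_sym (acong_rayr (acong_sym c) rKL LE)).
have EL : K = L by exact: scong_unique c1 (scong_swap d2) rKL.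
subst L.
suff <- : P = F by [].
apply: (scong_unique (scong_swap d1) c2).
apply: right_unique rL r' (same_sym _).
apply: (same_line _ _ _ s); [exact: nesym|exact: collinear_endr|exact: collinear_endl].
Qed.

(** * The Side-Angle-Side criterion *)

Lemma side_angle_side_angle A B C D E F :
  acong B A C E D F -> scong A B D E -> scong A C D F -> acong A C B D F E.
Proof.
move=> c c1 c2; have [n n' _] := c; have [[AB DE _] [nAC DF _]] := (c1, c2).
have nACB : ~ collinear A C B by incidence.
have nDFE : ~ collinear D F E by incidence.
have [H [cH footH]] := exists_foot nACB.
(* If H = A, the given sides are themselves the legs of right triangles. *)
have [HA'|HA'] := pselect (H = A).
  subst H; have r := footH C (collinear_endr _ _) (nesym nAC).
  have r' := right_transfer r (acong_swap c).
  by apply/acong_swap; apply: legs => //;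
    [exact: right_sym|exact: right_sym|exact: scong_swap].
have r := footH A (collinear_endl _ _) (nesym HA').
have [K [cK footK]] := exists_foot nDFE.
have KD : K <> D.
  move=> E0; subst K; have rFDE := footK F (collinear_endr _ _) (nesym DF).
  have := right_transfer rFDE (acong_swap (acong_sym c)).
  move=> r0; have := @right_line C A B H r0 (collinear_swap12 cH) HA'.
  by move=> /right_sym/right_not_right; apply; exact: right_sym.
have r' := footK D (collinear_endl _ _) (nesym KD).
have [nAHB _] := r; have [nDKE _] := r'.
(* First the acute case: K is on the ray DF, and the position of H relative to C decides between
   equality, subtraction, and passing to supplements at C and F. *)
have [rH|bH] := ray_or_bet nAC cH HA'.
  have rK := foot_ray c r r' rH cK.
  have cA := acong_sym (acong_rayr (acong_sym (acong_rayr c rH HA')) rK KD).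
  have [d1 /scong_swap d2 _] := hypotenuse_angle r r' c1 cA.
  have [EHC|HC] := pselect (H = C).
    subst H; have <- : K = F by exact: scong_unique d2 c2 (ray_sym DF rK KD).
    exact: right_acong.
  have rC := right_sym (footH C (collinear_endr _ _) (nesym HC)).
  have d3 := scong_swap d1.
  have [b|b|b] := bet_trichotomy (nesym HA') nAC HC ltac:(incidence).
  - have [b' d4] := scong_sub b (ray_sym DF rK KD) d2 c2.
    have [_ _ KF _] := bet_col b'.
    have rF := right_sym (footK F (collinear_endr _ _) (nesym KF)).
    have cl := acong_rayr (legs rC rF d1 d4) (bet_ray (bet_sym b)) nAC.
    exact/acong_swap/acong_sym/(acong_rayr (acong_sym cl) (bet_ray (bet_sym b')) DF).
  - by case: (ray_not_bet rH).
  - have [b' d4] := scong_sub b rK c2 d2.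
    have [_ _ FK _] := bet_col b'.
    have rF := right_sym (footK F (collinear_endr _ _) FK).
    have cl := legs rC rF d1 (scong_swap d4).
    exact: acong_supplement (bet_sym b) (bet_sym b') (acong_swap cl).
(* In the obtuse case both feet fall beyond the vertex; [HA] is applied to the supplements at A and
   D, and the segments are added. *)
have bK : between K D F.
  have [rK|//] := ray_or_bet DF cK KD.
  by case: (foot_not_bet (acong_sym c) r' r rK).
have cA := acong_supplement (bet_sym bH) (bet_sym bK) (acong_swap c).
have [d1 d2 _] := hypotenuse_angle r r' c1 (acong_swap cA).
have [[_ HC _ _] [_ KF _ _]] := (bet_col bH, bet_col bK).
have rC := right_sym (footH C (collinear_endr _ _) (nesym HC)).
have rF := right_sym (footK F (collinear_endr _ _) (nesym KF)).
have cl := acong_rayr (legs rC rF d1 (scong_bet bH bK d2 c2)) (bet_ray' (bet_sym bH)) nAC.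
exact/acong_swap/acong_sym/(acong_rayr (acong_sym cl) (bet_ray' (bet_sym bK)) DF).
Qed.

Lemma side_angle_side A B C D E F :
  acong B A C E D F -> scong A B D E -> scong A C D F -> cong_triangle A B C D E F.
Proof.
move=> c c1 c2; have [n n' _] := c.
have cC := side_angle_side_angle c c1 c2.
have cB := side_angle_side_angle (acong_swap c) c2 c1.
have [BC EF] : B <> C /\ E <> F by split; incidence.
(* To get BC congruent to EF, lay off BC as EX on the ray EF. The angle lemma applied at B and E
   makes EDX congruent to EDF, so X lies on both lines DF and EF. *)
have [X [rX cX]] := scong_copy BC EF.
have XE : X <> E by have [_ /nesym] := cX.
have cE := acong_sym (acong_rayr (acong_sym cB) rX XE).
have cD := acong_swap (side_angle_side_angle (acong_swap cE) cX (scong_swap c1)).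
have EXF : X = F.
  have EXF : collinear E F X := ray_col EF rX.
  have nEDF : ~ collinear E D F by [].
  have s : same E D F X by exact: ray_same rX XE.
  have sD : same D E X F.
    apply: (same_line _ _ _ (same_sym s));
      [incidence|exact: collinear_endr|exact: collinear_endl].
  have r : ray D X F.
    exact: acong_unique sD (acong_trans (acong_sym cD) (acong_swap c)).
  have DX : D <> X by have [_ ? _] := cD; incidence.
  have := ray_col DX r; incidence.
subst X.
have [[_ _ ?] [_ _ ?] [_ _ ?]] := (And3 c1 cX (scong_swap c2)).
by have [[_ _ ?] [_ _ ?] [_ _ ?]] := (And3 c cB cC).
Qed.

End HilbertPlane.

Unset Implicit Arguments.

Theorem theorem2p1 (G : geometry) (hM : Mminus G)
    (hHA : HA G) (hRCT : RCT G) (hPE : PE G) (A B C D E F : Point G) :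
  triangle A B C -> triangle D E F ->
  cong_seg (segment A B) (segment D E) ->
  cong_seg (segment A C) (segment D F) ->
  cong_ang (angle B A C) (angle E D F) ->
  cong_triangle A B C D E F.
Proof.
move=> t t' c1 c2 c.
have [AB nAC BC] := ncol_neq hM t; have [DE DF EF] := ncol_neq hM t'.
apply: side_angle_side => //; split=> //; by move=> /collinear_swap12.
Qed.
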